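(* Let $\mathcal P$ be a Preisach operator with weighting function $\mu$, and let $\mathcal H_{u,y}$ be a hysteresis loop obtained from an input-output pair $(u,y)$ of $\mathcal P$, i.e. $y=\mathcal P(u,L_0)$, where $u$ has maximum $u_{\max}$ and minimum $u_{\min}$. A point $(u_c,y_c)\in\mathcal H_{u,y}$ is a crossover point of $\mathcal H_{u,y}$ if and only if $$\iint_{(\alpha,\beta)\in\Omega_c}\mu(\alpha,\beta)\,d\alpha\,d\beta=0,$$ where $\Omega_c:=\{(\alpha,\beta)\in P\;|\;u_c<\alpha<u_{\max},\ u_{\min}<\beta<u_c\}$ and $P=\{(\alpha,\beta)\in\mathbb R^2\;|\;\alpha>\beta\}$.
   Context: $AC(\mathbb R_+,\mathbb R)$ denotes the absolutely continuous functions and $C_{\mathrm{pw}}$ the piecewise continuous functions; $\mathbb R_+=[0,\infty)$. ''Monotonically increasing/decreasing'' is meant in the weak sense. Relay operator: for $\alpha>\beta$ and $r_0\in\{-1,1\}$, $(\mathcal R^{\circlearrowleft}_{\alpha,\beta}(u,r_0))(t)=+1$ if $u(t)>\alpha$; $=-1$ if $u(t)<\beta$; $=(\mathcal R^{\circlearrowleft}_{\alpha,\beta}(u,r_0))(t_-)$ (the previous state is kept) if $\beta\le u(t)\le\alpha$ and $t>0$; $=r_0$ if $\beta\le u(t)\le\alpha$ and $t=0$. Preisach operator: $P:=\{(\alpha,\beta)\in\mathbb R^2\mid\alpha>\beta\}$ is the Preisach plane. The set of interfaces $\mathcal I$ consists of the monotonically decreasing staircase curves $L=\{\sigma(\gamma)\mid\gamma\in\mathbb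 R_+\}$, where $\sigma$ is a continuous map from $\mathbb R_+$ to $P$ (with starting point on the diagonal $\alpha=\beta$) such that $\lim_{\gamma\to\infty}\|\sigma(\gamma)\|=\infty$ and $\sigma(0)=(a,a)$ for some $a\in\mathbb R$; monotonically decreasing means that for all $(\alpha_1,\beta_1),(\alpha_2,\beta_2)\in L$, $\beta_1\le\beta_2$ implies $\alpha_1\ge\alpha_2$. For $L_0\in\mathcal I$ and $(\alpha,\beta)\in P$, put $r_{\alpha,\beta}(L_0)=+1$ if $L_0\cap\{(\alpha_1,\beta_1)\mid\alpha\le\alpha_1,\ \beta\le\beta_1\}\neq\emptyset$ and $r_{\alpha,\beta}(L_0)=-1$ otherwise. The Preisach operator with weighting function $\mu\in C_{\mathrm{pw}}(P,\mathbb R)$ (of arbitrary sign, and integrable on $P$ so that the integral is well-defined) is $$(\mathcal P(u,L_0))(t)=\iint_{(\alpha,\beta)\in P}\mu(\alpha,\beta)\,\big(\mathcal R^{\circlearrowleft}_{\alpha,\beta}(u,r_{\alpha,\beta}(L_0))\big)(t)\,d\alpha\,d\beta,$$ for $u\in AC(\mathbb R_+,\mathbb R)$, $L_0\in\mathcal I$. The initial interface is always assumed consistent with the input: $(u(0),u(0))\in L_0$. Hysteresis loop: let $u\in AC(\mathbb R_+,\mathbb R)$ be periodic with period $T>0$, with one maximum $u_{\max}$ and one minimum $u_{\min}$ in its periodic interval (over a suitable interval of length $T$, $u$ increases monotonically from $u_{\min}$ to $u_{\max}$ and then decreases monotonically back to $u_{\min}$), and let $y$ be the corresponding output. Assume there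 is $t_p\ge0$ such that $y$ is periodic (with period $T$) on $[t_p,\infty)$. The orbit $\mathcal H_{u,y}=\{(u(t),y(t))\mid t\in[t_p,\infty)\}$ is called a hysteresis loop if there exists $\upsilon\in\mathbb R$ such that the set $\{(\upsilon,\gamma)\in\mathcal H_{u,y}\mid\gamma\in\mathbb R\}$ has exactly two elements. Crossover point: choose $t_1\ge t_p$ and $t_1<t_2<t_1+T$ such that $u$ is monotonically increasing on $[t_1,t_2]$ and monotonically decreasing on $[t_2,t_1+T]$ (so $u(t_1)=u(t_1+T)=u_{\min}$, $u(t_2)=u_{\max}$), and set $\mathcal H^+_{u,y}=\{(u(t),y(t))\mid t\in[t_1,t_2]\}$, $\mathcal H^-_{u,y}=\{(u(t),y(t))\mid t\in[t_2,t_1+T]\}$. A point $(u_c,y_c)\in\mathcal H_{u,y}$ is a crossover point if $(u_c,y_c)\in\mathcal H^+_{u,y}\cap\mathcal H^-_{u,y}$. *)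

(* Defs.v *)
From HB Require Import structures.
From mathcomp Require Import all_boot all_order all_algebra.
From mathcomp Require Import all_classical all_reals all_analysis.
From mathcomp Require Import lra.

Set Implicit Arguments.
Unset Strict Implicit.
Unset Printing Implicit Defensive.

Import Order.TTheory GRing.Theory Num.Theory.
Import numFieldNormedType.Exports.

Local Open Scope classical_set_scope.
Local Open Scope ring_scope.

(* Functions on R_+ are represented by total functions on R whose values on
   the negative reals are never used; points of the plane are pairs
   (alpha, beta) = (x.1, x.2). *)

Section Defs.
Context {R : realType}.
Implicit Types (u y : R -> R) (L H : set (R * R)).

(* Absolute continuity on every interval [0, b]. *)
Definition abs_continuous_Rplus u : Prop :=
  forall b e : R, 0 < e -> exists2 d : R, 0 < d &
    forall (n : nat) (s t : 'I_n -> R),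
      (forall i, 0 <= s i /\ s i <= t i /\ t i <= b) ->
      trivIset [set: 'I_n] (fun i => [set x | s i < x < t i]) ->
      \sum_(i < n) (t i - s i) < d ->
      \sum_(i < n) `|u (t i) - u (s i)| < e.

Definition preisach_plane : set (R * R) := [set x | x.2 < x.1].

Definition lebesgue2 := ((@lebesgue_measure R) \x (@lebesgue_measure R))%E.

(* The pieces are disjoint open sets, locally finite in P and filling P up to
   a null set; on each piece mu has a continuous extension to the closure of
   the piece in P.  Nothing is imposed on the values of mu on the interfaces
   between the pieces. *)
Definition piecewise_continuous (mu : R * R -> R) : Prop :=
  exists D : nat -> set (R * R),
    (forall n, open (D n)) /\
    (forall n, D n `<=` preisach_plane) /\
    trivIset setT D /\
    (forall K, compact K -> K `<=` preisach_plane ->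
       finite_set [set n | D n `&` K !=set0]) /\
    lebesgue2.-negligible (preisach_plane `\` \bigcup_n D n) /\
    (forall n, exists g : R * R -> R,
       {within closure (D n) `&` preisach_plane, continuous g} /\
       (forall x, D n x -> mu x = g x)).

(* The value R(u, r0)(t_-) that the relay carries into time t when u(t) lies in
   [beta, alpha]: the one set when u was last outside [beta, alpha], and r0 if
   u has been in [beta, alpha] since time 0.  The equations of the relay alone
   would not determine it, since a left limit does not exclude a
   spontaneous switch just after a given time. *)
Definition relay_previous (alpha beta : R) u (r0 : R) (t : R) : R :=
  if `[< exists2 s, 0 <= s < t &
         alpha < u s /\ forall s', s <= s' < t -> beta <= u s' >] then 1
  else if `[< exists2 s, 0 <= s < t &
              u s < beta /\ forall s', s <= s' < t -> u s' <= alpha >] then -1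
  else r0.

Definition relay (alpha beta : R) u (r0 : R) (t : R) : R :=
  if alpha < u t then 1
  else if u t < beta then -1
  else if 0 < t then relay_previous alpha beta u r0 t
  else r0.

(* The remaining equation: the state at t is the left limit of the state. *)
Lemma relay_left_limit (alpha beta : R) u (r0 t : R) :
  beta < alpha -> 0 < t -> beta <= u t <= alpha ->
  u s @[s --> t^'-] --> u t ->
  relay alpha beta u r0 s @[s --> t^'-] --> relay alpha beta u r0 t.
Proof.
move=> ba t0 /andP[but uta] ut.
suff H : \forall s \near t^'-, relay alpha beta u r0 s = relay alpha beta u r0 t.
  apply: cvg_near_cst; exact: H.
have near_left (P : R -> Prop) : (\forall s \near t^'-, P s) ->
    exists2 c, 0 <= c < t & forall s, c < s < t -> P s.
  move=> nP; have [e /= e0 He] := nP.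
  exists (Num.max 0 (t - e)).
    by rewrite le_max lexx /= gt_max t0 gtrBl.
  move=> s /andP[]; rewrite gt_max => /andP[_ ts] st.
  by apply: He => //=; rewrite /ball /= gtr0_norm ?subr_gt0//; lra.
have relayt : relay alpha beta u r0 t = relay_previous alpha beta u r0 t.
  by rewrite /relay ltNge uta /= ltNge but /= t0.
have keep c : 0 <= c < t ->
    (forall s, c < s < t -> beta <= u s <= alpha) ->
    \forall s \near t^'-, relay alpha beta u r0 s = relay alpha beta u r0 t.
  move=> /andP[c0 ct] Hc; near=> s.
  have cs : c < s by near: s; exact: nbhs_left_gt.
  have st : s < t by near: s; exact: nbhs_left_lt.
  have /andP[bus usa] : beta <= u s <= alpha by apply: Hc; rewrite cs st.
  rewrite relayt /relay ltNge usa /= ltNge bus /= (le_lt_trans c0 cs).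
  rewrite /relay_previous.
  have E (Q S : R -> Prop) : (forall x, c < x < t -> ~ S x /\ Q x) ->
     (exists2 x, 0 <= x < s & S x /\ forall x', x <= x' < s -> Q x') <->
     (exists2 x, 0 <= x < t & S x /\ forall x', x <= x' < t -> Q x').
    move=> HQ; split=> -[x /andP[x0 xs] [Sx Qx]].
      exists x; first by rewrite x0 (lt_trans xs st).
      split=> // x' /andP[xx' x't]; have [x's|sx'] := ltP x' s.
        by apply: Qx; rewrite xx'.
      by have [] := HQ x' _; rewrite // x't (lt_le_trans cs).
    have xc : x <= c.
      by rewrite leNgt; apply/negP => cx; have [|] := HQ x _; rewrite ?cx.
    exists x; first by rewrite x0 (le_lt_trans xc).
    split=> // x' /andP[xx' x's]; apply: Qx.
    by rewrite xx' (lt_trans x's).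
  rewrite (asbool_equiv_eq (E (fun x => beta <= u x) (fun x => alpha < u x) _)).
    rewrite (asbool_equiv_eq (E (fun x => u x <= alpha) (fun x => u x < beta) _)) //.
    move=> x /Hc /andP[bx xa]; split=> //.
    by apply/negP; rewrite -leNgt.
  move=> x /Hc /andP[bx xa]; split=> //.
  by apply/negP; rewrite -leNgt.
have [um|um] := leP (u t) ((alpha + beta) / 2).
- have /near_left[c ct Hc] : \forall s \near t^'-, u s <= alpha.
    have : \forall v \near u t, v <= alpha.
      near=> v; apply: ltW; near: v; apply: lt_nbhsl; lra.
    exact: ut.
  have [[s0 /andP[cs0 s0t] us0]|N] :=
      pselect (exists2 s0, c < s0 < t & u s0 < beta).
    have s00 : 0 < s0 by case/andP: ct => c0 _; exact: le_lt_trans cs0.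
    have key s : s0 < s <= t -> relay_previous alpha beta u r0 s = -1.
      move=> /andP[s0s st]; rewrite /relay_previous.
      case: asboolP => [[s1 /andP[s10 s1s] [as1 H1]]|_].
        have s1c : s1 <= c.
          rewrite leNgt; apply/negP => cs1.
          have := Hc s1; rewrite cs1 (lt_le_trans s1s st) => /(_ isT).
          by rewrite leNgt as1.
        have := H1 s0; rewrite (le_trans s1c (ltW cs0)) s0s => /(_ isT).
        by rewrite leNgt us0.
      case: asboolP => // -[]; exists s0; first by rewrite (ltW s00) s0s.
      split=> // s' /andP[s0s' s's]; apply: Hc.
      by rewrite (lt_le_trans cs0 s0s') (lt_le_trans s's st).
    near=> s.
    have s0s : s0 < s by near: s; exact: nbhs_left_gt.
    have st : s < t by near: s; exact: nbhs_left_lt.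
    rewrite relayt key ?s0t ?lexx// /relay ltNge.
    rewrite Hc ?st ?(lt_trans cs0)//=.
    case: ifPn => // ub; rewrite (lt_trans s00 s0s) key//.
    by rewrite s0s ltW.
  apply: (keep c) => // s cst; rewrite Hc// andbT leNgt; apply/negP => us.
  by apply: N; exists s.
- have /near_left[c ct Hc] : \forall s \near t^'-, beta <= u s.
    have : \forall v \near u t, beta <= v.
      near=> v; apply: ltW; near: v; apply: lt_nbhsr; lra.
    exact: ut.
  have [[s0 /andP[cs0 s0t] us0]|N] :=
      pselect (exists2 s0, c < s0 < t & alpha < u s0).
    have s00 : 0 < s0 by case/andP: ct => c0 _; exact: le_lt_trans cs0.
    have key s : s0 < s <= t -> relay_previous alpha beta u r0 s = 1.
      move=> /andP[s0s st]; rewrite /relay_previous.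
      case: asboolP => // -[]; exists s0; first by rewrite (ltW s00) s0s.
      split=> // s' /andP[s0s' s's]; apply: Hc.
      by rewrite (lt_le_trans cs0 s0s') (lt_le_trans s's st).
    near=> s.
    have s0s : s0 < s by near: s; exact: nbhs_left_gt.
    have st : s < t by near: s; exact: nbhs_left_lt.
    rewrite relayt key ?s0t ?lexx// /relay.
    case: ifPn => // _; rewrite ltNge Hc ?st ?(lt_trans cs0)//=.
    by rewrite (lt_trans s00 s0s) key// s0s ltW.
  apply: (keep c) => // s cst; rewrite Hc//= leNgt; apply/negP => us.
  by apply: N; exists s.
Unshelve. all: by end_near. Qed.

(* Only the starting point lies on the diagonal, i.e. on the boundary of P. *)
Definition interface L : Prop :=
  exists sigma : R -> R * R,
    {within [set c | 0 <= c], continuous sigma} /\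
    (exists a, sigma 0 = (a, a)) /\
    (forall c, 0 < c -> preisach_plane (sigma c)) /\
    `|sigma c| @[c --> +oo] --> +oo /\
    L = sigma @` [set c | 0 <= c] /\
    (forall x1 x2, L x1 -> L x2 -> x1.2 <= x2.2 -> x2.1 <= x1.1).

Definition initial_state L (x : R * R) : R :=
  if `[< L `&` [set z | x.1 <= z.1 /\ x.2 <= z.2] !=set0 >] then 1 else -1.

Definition preisach (mu : R * R -> R) u L (t : R) : R :=
  \int[lebesgue2]_(x in preisach_plane)
    (mu x * relay x.1 x.2 u (initial_state L x) t).

Definition rise_fall u (T t1 t2 : R) : Prop :=
  0 <= t1 /\ t1 < t2 /\ t2 < t1 + T /\
  {in `[t1, t2] &, {homo u : s t / s <= t}} /\
  {in `[t2, t1 + T] &, {homo u : s t /~ s <= t}}.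

Definition periodic_from (f : R -> R) (T t0 : R) : Prop :=
  forall t, t0 <= t -> f (t + T) = f t.

Definition loop_input u (T umin umax : R) : Prop :=
  abs_continuous_Rplus u /\ 0 < T /\ periodic_from u T 0 /\
  exists s1 s2, rise_fall u T s1 s2 /\ u s1 = umin /\ u s2 = umax.

Definition io_orbit u y (J : set R) : set (R * R) := (fun t => (u t, y t)) @` J.

Definition hysteresis_loop H : Prop :=
  exists v : R, ([set p | H p /\ p.1 = v] #= `I_2)%card.

Definition crossover_point u y (T tp t1 t2 : R) (p : R * R) : Prop :=
  io_orbit u y [set t | tp <= t] p /\
  (io_orbit u y [set t | t1 <= t <= t2] `&`
   io_orbit u y [set t | t2 <= t <= t1 + T]) p.

Definition Omega (umin umax uc : R) : set (R * R) :=
  [set x | preisach_plane x /\ uc < x.1 < umax /\ umin < x.2 < uc].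

End Defs.

(* Main.v *)
Require Import Defs.
From HB Require Import structures.
From mathcomp Require Import all_boot all_order all_algebra.
From mathcomp Require Import all_classical all_reals all_analysis.
From mathcomp Require Import measurable_realfun lra.
Import Order.TTheory GRing.Theory Num.Theory.
Import numFieldNormedType.Exports.
Local Open Scope classical_set_scope.
Local Open Scope ring_scope.

(** After one full period the state of every relay is explicit. At equal input
values the falling branch differs from the rising one only through the relays
with [umin < beta <= uc <= alpha < umax], which are [+1] when falling and [-1]
when rising. Hence the outputs of the two branches at the input value [uc]
differ by twice the integral of [mu] over [Omega], up to two null lines, and the
branches meet at [uc] exactly when that integral vanishes. The relays with
[beta <= umin] and [umax <= alpha] keep their initial state, so splitting the
integral requires the set below the initial interface to be Borel. *)

(** * Relay state determined by the history of the input *)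

Section Relay.
Context {R : realType}.
Implicit Types (alpha beta r s t : R) (u : R -> R).

(** If [u t <= alpha], then [s < t], and [s] itself witnesses the first clause of
    [relay_previous]. *)
Lemma relay_of_high alpha beta u r s t : 0 <= s <= t -> alpha < u s ->
  (forall s', s <= s' <= t -> beta <= u s') -> relay alpha beta u r t = 1.
Proof.
move=> /andP[s0 st] us H; rewrite /relay; case: ltP => // ut.
rewrite ltNge H ?st ?lexx//=.
have {}st : s < t.
  by rewrite lt_neqAle st andbT; apply: contraTneq us => ->; rewrite -leNgt.
rewrite (le_lt_trans s0 st) /relay_previous asboolT//.
exists s; first by rewrite s0.
by split=> // s' /andP[ss' s't]; apply: H; rewrite ss' ltW.
Qed.

Lemma relay_of_low alpha beta u r s t : 0 <= s <= t -> u s < beta ->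
  (forall s', s <= s' <= t -> u s' <= alpha) -> relay alpha beta u r t = -1.
Proof.
move=> /andP[s0 st] us H; rewrite /relay ltNge H ?st ?lexx//=.
case: ltP => // ut.
have {}st : s < t.
  by rewrite lt_neqAle st andbT; apply: contraTneq us => ->; rewrite -leNgt.
rewrite (le_lt_trans s0 st) /relay_previous asboolF ?asboolT//.
  exists s; first by rewrite s0.
  by split=> // s' /andP[ss' s't]; apply: H; rewrite ss' ltW.
(* A witness [s1] of the first clause is impossible: from [s] on the input stays at most [alpha],
   and a witness before [s] would forbid [u s < beta]. *)
move=> [s1 /andP[_ s1t] [us1 H1]]; have [ss1|s1s] := leP s s1.
  by have := H s1; rewrite ss1 ltW// leNgt us1 => /(_ isT).
by have := H1 s; rewrite (ltW s1s) st leNgt us => /(_ isT).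
Qed.

Lemma relay_of_between alpha beta u r t : 0 <= t ->
  (forall s, 0 <= s <= t -> beta <= u s <= alpha) -> relay alpha beta u r t = r.
Proof.
move=> t0 H; have := H t; rewrite t0 lexx => /(_ isT) /andP[but uta].
rewrite /relay ltNge uta /= ltNge but /=; case: ltP => // {}t0.
rewrite /relay_previous !asboolF// => -[s /andP[s0 st] [us _]].
  by have := H s; rewrite s0 ltW// => /(_ isT)/andP[]; rewrite leNgt us.
by have := H s; rewrite s0 ltW// => /(_ isT)/andP[_]; rewrite leNgt us.
Qed.

End Relay.

(** * Measurability of the initial relay state *)

Section Measurability.
Context {R : realType}.
Local Notation plane := (measurableTypeR R * measurableTypeR R)%type.

(* Down-closed sets of the plane need not be Borel; this one is, because its
   complement is a countable union of open quadrants with rational corner. *)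
Lemma measurable_down_compact (K : set (R * R)) : compact K ->
  measurable ([set x | exists2 z, K z & x.1 <= z.1 /\ x.2 <= z.2] : set plane).
Proof.
move=> /compact_near_coveringP cK; rewrite -[X in measurable X]setCK.
apply: measurableC.
pose E (p q : rat) : set plane :=
  if `[< exists2 z, K z & ratr p <= z.1 /\ ratr q <= z.2 >] then set0
  else `]ratr p, +oo[ `*` `]ratr q, +oo[.
suff -> : ~` [set x | exists2 z, K z & x.1 <= z.1 /\ x.2 <= z.2] =
    \bigcup_p \bigcup_q E p q.
  apply: bigcupT_measurable_rat => p; apply: bigcupT_measurable_rat => q.
  by rewrite /E; case: asboolP => // _; exact: measurableX.
apply/seteqP; split=> [x Nx|x [p _ [q _]]]; last first.
  rewrite /E; case: asboolP => // NK /= [].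
  rewrite !in_itv /= !andbT => px qx [z Kz [xz1 xz2]]; apply: NK; exists z => //.
  by split; [exact: le_trans (ltW px) xz1|exact: le_trans (ltW qx) xz2].
(* Compactness of [K] makes the margin [e] uniform, which leaves room for a corner with rational
   coordinates just below those of [x]. *)
have : \forall e \near 0^'+, K `<=` [set z | ~ (x.1 - e <= z.1 /\ x.2 - e <= z.2)].
  apply: (cK R (0^'+) (fun e z => ~ (x.1 - e <= z.1 /\ x.2 - e <= z.2)) _) => z Kz.
  have [zx|xz1] := ltP z.1 x.1.
    have near1 : \forall z' \near z, z'.1 < (z.1 + x.1) / 2.
      exists ([set a | a < (z.1 + x.1) / 2], setT) => /=; last by move=> ? [].
      by split; [apply: lt_nbhsl; lra|exact: filterT].
    near=> z' e => /= -[+ _]; apply/negP; rewrite -ltNge.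
    have : z'.1 < (z.1 + x.1) / 2.
      near: z'; exact: near1.
    have : e < (x.1 - z.1) / 2.
      near: e; apply: nbhs_right_lt; lra.
    by lra.
  have [zx|xz2] := ltP z.2 x.2; last by case: Nx; exists z.
  have near2 : \forall z' \near z, z'.2 < (z.2 + x.2) / 2.
    exists (setT, [set b | b < (z.2 + x.2) / 2]) => /=; last by move=> ? [].
    by split; [exact: filterT|apply: lt_nbhsl; lra].
  near=> z' e => /= -[_]; apply/negP; rewrite -ltNge.
  have : z'.2 < (z.2 + x.2) / 2.
    near: z'; exact: near2.
  have : e < (x.2 - z.2) / 2.
    near: e; apply: nbhs_right_lt; lra.
  by lra.
move=> /(filterI (nbhs_right_gt 0)) /filter_ex [e [/= e0 NK]].
have [p] := @rat_in_itvoo _ (x.1 - e) x.1 ltac:(lra).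
have [q] := @rat_in_itvoo _ (x.2 - e) x.2 ltac:(lra).
rewrite !in_itv /= => /andP[q1 q2] /andP[p1 p2].
exists p => //; exists q => //; rewrite /E asboolF.
  by split=> /=; rewrite in_itv /= ?p2 ?q2.
move=> [z Kz [pz qz]]; apply: (NK z Kz); split.
  exact: le_trans (ltW p1) pz.
exact: le_trans (ltW q1) qz.
Unshelve. all: by end_near. Qed.

(** The parameter half-line is exhausted by the segments [[0, n]], whose images under [sigma] are
    compact. *)
Lemma measurable_down_interface (L : set (R * R)) : interface L ->
  measurable
    ([set x | L `&` [set z | x.1 <= z.1 /\ x.2 <= z.2] !=set0] : set plane).
Proof.
move=> [sigma [sigma_cont [_ [_ [_ [-> _]]]]]].
rewrite (_ : [set _ | _] = \bigcup_n [set x | exists2 z,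
    (sigma @` `[0, n%:R]) z & x.1 <= z.1 /\ x.2 <= z.2]).
  apply: bigcup_measurable => n _; apply: measurable_down_compact.
  apply: continuous_compact; last exact: segment_compact.
  by apply: continuous_subspaceW sigma_cont => c /=; rewrite in_itv /= => /andP[].
apply/seteqP; split=> x /=.
  move=> [z [[c /= c0 <-] xz]]; exists (Num.truncn c).+1 => //.
  exists (sigma c) => //; exists c => //=.
  by rewrite in_itv /= c0 ltW// truncnS_gt.
move=> [n _ [_ [c + <-] xz]]; rewrite /= in_itv /= => /andP[c0 _].
by exists (sigma c); split=> //; exists c.
Qed.

Lemma measurable_fun_initial_state (L : set (R * R)) : interface L ->
  measurable_fun setT (initial_state L : plane -> R).
Proof.
move=> /measurable_down_interface mL.
apply: measurable_fun_ifT => //; apply: (measurable_fun_bool true); rewrite setTI.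
rewrite (_ : _ @^-1` _ =
  [set x | L `&` [set z | x.1 <= z.1 /\ x.2 <= z.2] !=set0])//.
by apply/seteqP; split=> x /asboolP.
Qed.

End Measurability.

(** * Periodic inputs and the relay states on each branch *)

Section PeriodicInput.
Context {R : realType}.
Implicit Types (u y : R -> R) (T : R).

Lemma periodic_from_mulrn {u T p t} n : 0 < T -> periodic_from u T p -> p <= t ->
  u (t + T *+ n) = u t.
Proof.
move=> T0 uT pt; elim: n => [|n IH]; first by rewrite mulr0n addr0.
by rewrite mulrSr addrA uT// (le_trans pt)// lerDl mulrn_wge0// ltW.
Qed.

(** The time [t'] is chosen before the function, so that input and output can be moved to the same
    time. *)
Lemma periodic_from_window {T p a t} : 0 < T -> p <= a -> p <= t ->
  exists2 t', a <= t' <= a + T & forall u, periodic_from u T p -> u t = u t'.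
Proof.
move=> T0 pa pt; pose k := Num.floor ((t - a) / T).
have [k1 k2] : k%:~R * T <= t - a /\ t - a < (k + 1)%:~R * T.
  by rewrite -ler_pdivlMr// -ltr_pdivrMr// floor_le floorD1_gt.
exists (t - k%:~R * T).
  by move: k2; rewrite intrD mulrDl mul1r; lra.
(* For [k >= 0] the shift starts from [t'], for [k < 0] from [t], since periodicity holds only from
   [p] on. *)
move=> u uT; case: k k1 k2 => n k1 k2.
  rewrite -[RHS](periodic_from_mulrn n T0 uT).
    by congr u; rewrite -[T *+ n]mulr_natl -pmulrn; lra.
  by apply: le_trans pa _; lra.
rewrite -(periodic_from_mulrn n.+1 T0 uT pt); congr u.
by rewrite -[T *+ _]mulr_natl NegzE mulrNz; lra.
Qed.

Lemma rise_fall_period_gt0 {u T t1 t2} : rise_fall u T t1 t2 -> 0 < T.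
Proof. by move=> [t10 [t12 [t21 _]]]; lra. Qed.

Lemma rise_fall_le {u T t1 t2 a b} : rise_fall u T t1 t2 ->
  t1 <= a -> a <= b -> b <= t2 -> u a <= u b.
Proof.
by move=> [_ [_ [_ [+ _]]]] *; apply => //; rewrite in_itv /=; lra.
Qed.

Lemma rise_fall_ge {u T t1 t2 a b} : rise_fall u T t1 t2 ->
  t2 <= a -> a <= b -> b <= t1 + T -> u b <= u a.
Proof.
by move=> [_ [_ [_ [_ ]]]] + *; apply => //; rewrite in_itv /=; lra.
Qed.

Lemma rise_fall_range {u T t1 t2 t} : periodic_from u T 0 ->
  rise_fall u T t1 t2 -> 0 <= t -> u t1 <= u t <= u t2.
Proof.
move=> uT ut t0; have [t10 [t12 [t21 _]]] := ut.
have T0 := rise_fall_period_gt0 ut.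
have [s s1 /(_ _ uT) ->] := periodic_from_window T0 t10 t0.
have [st2|t2s] := leP s t2.
  rewrite (rise_fall_le ut) ?(rise_fall_le ut)//; lra.
rewrite -(uT t1)// (rise_fall_ge ut) ?(rise_fall_ge ut)//; lra.
Qed.

(** By time [t + T] the input has passed the maximum at [t2] and then the minimum at [t1 + T]. The
    minimum is more recent, so the test [u t1 < beta] precedes [alpha < u t2]; a relay switched by
    neither extreme keeps [r]. *)
Lemma relay_rise alpha beta {u} r {T t1 t2 t} : periodic_from u T 0 ->
  rise_fall u T t1 t2 -> t1 <= t <= t2 ->
  relay alpha beta u r (t + T) =
  if alpha < u t then 1 else if u t < beta then -1
  else if u t1 < beta then -1 else if alpha < u t2 then 1 else r.
Proof.
move=> uT ut /andP[t1t tt2]; have T0 := rise_fall_period_gt0 ut.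
have [t10 [t12 [t21 _]]] := ut.
have range x : 0 <= x -> u t1 <= u x <= u t2 by exact: rise_fall_range uT ut.
have utT : u (t + T) = u t by apply: uT; lra.
case: ifPn => [aut|uta]; first by rewrite /relay utT aut.
case: ifPn => [utb|but]; first by rewrite /relay utT (negbTE uta) utb.
rewrite -leNgt in uta; rewrite -leNgt in but.
case: ifPn => [u1b|bu1].
  apply: (relay_of_low _ _ _ _ (t1 + T)); first lra.
    by rewrite uT.
  move=> s /andP[s1 s2]; rewrite -[s](subrK T) uT; last lra.
  by apply: le_trans uta; apply: rise_fall_le ut _ _ _; lra.
rewrite -leNgt in bu1; case: ifPn => [au2|u2a].
  apply: (relay_of_high _ _ _ _ t2) => //; first lra.
  by move=> s /andP[s1 s2]; apply: le_trans bu1 _; have := range s; lra.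
rewrite -leNgt in u2a; apply: relay_of_between; first lra.
by move=> s /andP[s0 _]; have := range s s0; lra.
Qed.

(** Here the maximum at [t2 + T] is the most recent extreme, so the two inner tests come in the
    opposite order to [relay_rise]. *)
Lemma relay_fall alpha beta {u} r {T t1 t2 t} : periodic_from u T 0 ->
  rise_fall u T t1 t2 -> t2 <= t <= t1 + T ->
  relay alpha beta u r (t + T) =
  if alpha < u t then 1 else if u t < beta then -1
  else if alpha < u t2 then 1 else if u t1 < beta then -1 else r.
Proof.
move=> uT ut /andP[t2t tt1]; have T0 := rise_fall_period_gt0 ut.
have [t10 [t12 [t21 _]]] := ut.
have range x : 0 <= x -> u t1 <= u x <= u t2 by exact: rise_fall_range uT ut.
have utT : u (t + T) = u t by apply: uT; lra.
case: ifPn => [aut|uta]; first by rewrite /relay utT aut.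
case: ifPn => [utb|but]; first by rewrite /relay utT (negbTE uta) utb.
rewrite -leNgt in uta; rewrite -leNgt in but.
case: ifPn => [au2|u2a].
  apply: (relay_of_high _ _ _ _ (t2 + T)); first lra.
    by rewrite uT//; lra.
  move=> s /andP[s1 s2]; rewrite -[s](subrK T) uT; last lra.
  by apply: le_trans but _; apply: rise_fall_ge ut _ _ _; lra.
rewrite -leNgt in u2a; case: ifPn => [u1b|bu1].
  apply: (relay_of_low _ _ _ _ t1) => //; first lra.
  by move=> s /andP[s1 s2]; apply: le_trans u2a; have := range s; lra.
rewrite -leNgt in bu1; apply: relay_of_between; first lra.
by move=> s /andP[s0 _]; have := range s s0; lra.
Qed.

(** Absolute continuity is applied to a single interval, [n = 1]. *)
Lemma abs_continuous_itv u a b : 0 <= a -> abs_continuous_Rplus u ->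
  {within `[a, b], continuous u}.
Proof.
move=> a0 uac; apply/subspace_continuousP => x /= /[!in_itv] /= /andP[ax xb].
apply/cvgrPdist_lt => e e0; have [d d0 Hd] := uac b e e0.
have close s t : 0 <= s -> s <= t -> t <= b -> t - s < d -> `|u t - u s| < e.
  move=> s0 st tb std; have := Hd 1%N (fun=> s) (fun=> t).
  rewrite !big_ord1; apply => //.
  by move=> i j _ _ _; rewrite (ord1 i) (ord1 j).
near=> z.
have azb : z \in `[a, b] by near: z; exact: withinT.
have : `|x - z| < d.
  near: z; apply: cvg_within; exists d => //.
move: azb; rewrite in_itv /= => /andP[az zb].
have [xz|zx] := leP x z; rewrite ltr_distl => xzd.
  by rewrite distrC; apply: close => //; lra.
by apply: close => //; lra.
Unshelve. all: by end_near. Qed.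

End PeriodicInput.

(** * Difference of the outputs on the two branches *)

Section Output.
Context {R : realType}.
Local Notation plane := (measurableTypeR R * measurableTypeR R)%type.
Implicit Types (mu : R * R -> R) (u y : R -> R) (L : set (R * R)).

Lemma measurable_preisach_plane :
  measurable (preisach_plane : set plane).
Proof.
rewrite -[X in measurable X]setTI.
have mlt : measurable_fun setT (fun x : plane => x.2 < x.1).
  by apply: measurable_fun_ltr; [exact: measurable_snd|exact: measurable_fst].
exact: (mlt measurableT [set true]).
Qed.

Lemma measurable_fun_relay_rise u L T t1 t2 t : interface L ->
  periodic_from u T 0 -> rise_fall u T t1 t2 -> t1 <= t <= t2 ->
  measurable_fun setT
    ((fun x => relay x.1 x.2 u (initial_state L x) (t + T)) : plane -> R).
Proof.
move=> Li uT ut tt.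
rewrite (_ : (fun x => _) = fun x : plane =>
  if x.1 < u t then 1 else if u t < x.2 then -1
  else if u t1 < x.2 then -1 else if x.1 < u t2 then 1
  else initial_state L x); last first.
  by apply/funext => x; rewrite (relay_rise _ _ _ uT ut tt).
have m1 c : measurable_fun setT (fun x : plane => x.1 < c).
  by apply: measurable_fun_ltr; [exact: measurable_fst|exact: measurable_cst].
have m2 c : measurable_fun setT (fun x : plane => c < x.2).
  by apply: measurable_fun_ltr; [exact: measurable_cst|exact: measurable_snd].
do 4 (apply: measurable_fun_ifT => //).
exact: measurable_fun_initial_state.
Qed.

Lemma preisach_fall_sub_rise mu u L T t1 t2 t s :
  lebesgue2.-integrable preisach_plane (EFin \o mu) -> interface L ->
  periodic_from u T 0 -> rise_fall u T t1 t2 ->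
  t1 <= t <= t2 -> t2 <= s <= t1 + T -> u s = u t ->
  preisach mu u L (s + T) - preisach mu u L (t + T) =
  2 * \int[lebesgue2]_(x in Omega (u t1) (u t2) (u t)) mu x.
Proof.
move=> imu Li uT ut tt ss ust.
(* [D] consists of exactly the relays whose states differ on the two branches. It is closed at [u t]
   because a relay keeps its state when the input equals a threshold. *)
pose D : set plane :=
  preisach_plane `&` (`[u t, u t2[ `*` `]u t1, u t]).
have mP := measurable_preisach_plane.
have mD : measurable D by apply: measurableI => //; exact: measurableX.
have iD : lebesgue2.-integrable D (EFin \o mu).
  by apply: integrableS imu => // x [].
have -> : \int[lebesgue2]_(x in Omega (u t1) (u t2) (u t)) mu x =
          \int[lebesgue2]_(x in D) mu x.
  (* [D] exceeds [Omega] only on the lines [alpha = u t] and [beta = u t], which are null for the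
     product measure. *)
  pose N : set plane := ([set u t] `*` setT) `|` (setT `*` [set u t]).
  have mN1 : measurable ([set u t] `*` setT : set plane) by exact: measurableX.
  have mN2 : measurable (setT `*` [set u t] : set plane) by exact: measurableX.
  rewrite /Rintegral; congr fine.
  rewrite [RHS](negligible_integral (N := N))//; first last.
  - apply/eqP; rewrite eq_le measure_ge0 andbT.
    apply: le_trans (measureU2 _ mN1 mN2) _.
    have lX (A B : set (measurableTypeR R)) : measurable A -> measurable B ->
        lebesgue2 (A `*` B) = (lebesgue_measure A * lebesgue_measure B)%E.
      exact: product_measure1E.
    change (lebesgue2 ([set u t] `*` setT) +
      lebesgue2 (setT `*` [set u t]) <= 0)%E.
    by rewrite !lX// !lebesgue_measure_set1 mul0e mule0 adde0.
  - exact: measurableU.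
  congr (integral _ _ _).
  apply/seteqP; split=> [[a b] /= [ab [/andP[a1 a2] /andP[b1 b2]]]|].
    split; first by split=> //=; rewrite !in_itv /= a2 b1 !ltW.
    by move=> /= [[ac _]|[_ bc]]; move: a1 b2; rewrite ?ac ?bc ltxx.
  move=> [a b] [[/= ab []]]; rewrite !in_itv /= => /andP[a1 a2] /andP[b1 b2] NN.
  split=> //=; rewrite a2 b1 /= andbT !lt_neqAle a1 b2 !andbT.
  by split; apply/negP => /eqP E; apply: NN; [left|right].
have iDP : lebesgue2.-integrable preisach_plane (EFin \o (mu \_ D)).
  rewrite -restrict_EFin; apply/integrable_restrict => //.
  by rewrite setIA setIid.
have -> : \int[lebesgue2]_(x in D) mu x =
          \int[lebesgue2]_(x in preisach_plane) (mu \_ D) x.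
  by rewrite -Rintegral_mkcondr setIidr// => x [].
rewrite -RintegralZl//.
(* Written as a sum, the identity needs integrability only of the rising integrand and of [2 * mu]
   restricted to [D]. *)
apply/eqP; rewrite subr_eq [eqbRHS]addrC; apply/eqP.
rewrite /preisach -RintegralD//.
- apply: eq_Rintegral => -[a b] /[!inE] /= ba.
  rewrite (relay_rise _ _ _ uT ut tt).
  (* Outside [D] the restriction takes the default value [point], which is 0 in [R]. *)
  rewrite (relay_fall _ _ _ uT ut ss) ust patchE (_ : point = 0 :> R)//.
  have -> : ((a, b) \in D) = [&& u t <= a, a < u t2, u t1 < b & b <= u t].
    apply/idP/idP.
      rewrite inE => -[_ [/=]]; rewrite !in_itv /=.
      by move=> /andP[-> ->] /andP[-> ->].
    move=> /and4P[a1 a2 b1 b2]; rewrite inE; split => //=.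
    by rewrite !in_itv /= a1 a2 b1 b2.
  (* Inside [D] the claim reads [mu = - mu + 2 * mu]; outside, both formulas give the same state. *)
  case: (ltP a (u t)) => /= _; first lra.
  case: (ltP (u t) b) => /= _; first by rewrite !andbF; lra.
  by case: (ltP a (u t2)) => /= _; case: (ltP (u t1) b) => /= _; lra.
- pose h (x : plane) := relay x.1 x.2 u (initial_state L x) (t + T).
  have mh : measurable_fun preisach_plane h.
    by apply: measurable_funTS; exact: measurable_fun_relay_rise Li uT ut tt.
  have bh : [bounded h x | x in preisach_plane].
    exists 1; split=> // M M1 x _; apply: le_trans (ltW M1).
    rewrite /h (relay_rise _ _ _ uT ut tt) /initial_state.
    repeat (case: ifP => _; first by rewrite ?normrN normr1).
    by rewrite normrN normr1.
  exact: (integrableMl mP imu mh bh).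
- exact: (integrableZl mP 2 iDP).
Qed.

End Output.

(** * Crossover points and the integral over [Omega] *)

Theorem mainTheorem2 (R : realType) (mu : R * R -> R) (L0 : set (R * R))
  (u y : R -> R) (T umin umax tp t1 t2 uc yc : R)
  (hmu : piecewise_continuous mu)
  (imu : lebesgue2.-integrable preisach_plane (EFin \o mu))
  (hL0 : interface L0)
  (hu : loop_input u T umin umax)
  (hu0 : L0 (u 0, u 0))
  (hy : forall t : R, 0 <= t -> y t = preisach mu u L0 t)
  (htp : 0 <= tp)
  (hyT : periodic_from y T tp)
  (hH : hysteresis_loop (io_orbit u y [set t | tp <= t]))
  (ht1 : tp <= t1)
  (ht : rise_fall u T t1 t2)
  (hc : io_orbit u y [set t | tp <= t] (uc, yc)) :
  crossover_point u y T tp t1 t2 (uc, yc) <->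
  \int[lebesgue2]_(x in Omega umin umax uc) mu x = 0.
Proof.
have [uac [T0 [uT [s1 [s2 [hs [us1 us2]]]]]]] := hu.
have [t10 [t12 [t21 _]]] := ht; have [s10 [s12 [s21 _]]] := hs.
have t20 : 0 <= t2 by exact: le_trans t10 (ltW t12).
have range t : 0 <= t -> u t1 <= u t <= u t2 by exact: rise_fall_range uT ht.
have ranges t : 0 <= t -> umin <= u t <= umax.
  by rewrite -us1 -us2; exact: rise_fall_range uT hs.
(* The times [s1], [s2] may differ from [t1], [t2], but the values at each pair bound the input at
   all nonnegative times, so the extremes agree. *)
have umin1 : umin = u t1.
  have := range s1 s10; have := ranges t1 t10; lra.
have umax2 : umax = u t2.
  have := range s2 ltac:(lra); have := ranges t2 ltac:(lra); lra.
have dy t s : t1 <= t <= t2 -> t2 <= s <= t1 + T -> u t = uc -> u s = uc ->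
    y s - y t = 2 * \int[lebesgue2]_(x in Omega umin umax uc) mu x.
  (* Periodicity of [y] moves both times one period later, where the relay states are explicit. *)
  move=> tt ss utc usc; rewrite umin1 umax2 -utc -(hyT t) -1?(hyT s); try lra.
  rewrite !hy; try lra.
  by apply: preisach_fall_sub_rise => //; rewrite usc.
split.
  move=> [_ [[t /= tt [utc ytc]] [s /= ss [usc ysc]]]].
  by have := dy t s tt ss utc usc; lra.
move=> Om0; split => //; have [t /= tpt [utc ytc]] := hc.
have u_cont a b : 0 <= a -> {within `[a, b], continuous u}.
  by move=> a0; exact: abs_continuous_itv.
have [t' tt' E] := periodic_from_window T0 ht1 tpt.
have ut'c : u t' = uc.
  by rewrite -utc -E// => x xtp; apply: uT; exact: le_trans xtp.
have yt'c : y t' = yc by rewrite -ytc -E.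
have uT1 : u (t1 + T) = u t1 by exact: uT.
have uc_range : u t1 <= uc <= u t2 by rewrite -ut'c; apply: range; lra.
(* The point lies on one branch at [t']. The intermediate value theorem gives a time on the other
   branch with input [uc], and the vanishing integral makes the outputs equal. *)
have [t't2|t2t'] := leP t' t2.
- have [|s] := @IVT _ u t2 (t1 + T) uc (ltW t21) (u_cont _ _ t20).
    by rewrite uT1 ge_min le_max; case/andP: uc_range => -> ->; rewrite orbT.
  rewrite in_itv /= => ss usc.
  have tt : t1 <= t' <= t2 by rewrite t't2 andbT; case/andP: tt'.
  split; [exists t' => //=|exists s => //=]; congr pair => //.
  by have := dy t' s tt ss ut'c usc; rewrite Om0; lra.
- have [|s] := @IVT _ u t1 t2 uc (ltW t12) (u_cont _ _ t10).
    by rewrite ge_min le_max; case/andP: uc_range => -> ->; rewrite orbT.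
  rewrite in_itv /= => ss usc.
  have tt : t2 <= t' <= t1 + T by rewrite (ltW t2t'); case/andP: tt'.
  split; [exists s => //=|exists t' => //=]; congr pair => //.
  by have := dy s t' ss tt usc ut'c; rewrite Om0; lra.
Qed.
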